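(* Let $V$ be a vector space (of arbitrary, possibly infinite, dimension) over a field $\mathbb K$ and let $V^*$ be its algebraic dual. Let $\mathcal O:V\to V$ be a linear operator and let $\mathcal O^*:V^*\to V^*$ be its dual operator. Then $\mathcal O$ is injective if and only if $\mathcal O^*$ is surjective.
   Context: The algebraic dual $V^*$ is the space of all $\mathbb K$-linear functionals $V\to\mathbb K$. The dual operator $\mathcal O^*$ is defined by $\mathcal O^*(T)=T\circ\mathcal O$ for all $T\in V^*$. The axiom of choice is assumed. *)

(* Defs.v *)
From HB Require Import structures.
From mathcomp Require Import all_boot all_algebra.
From mathcomp Require Import boolp classical_sets functions.

Set Implicit Arguments.
Unset Strict Implicit.
Unset Printing Implicit Defensive.

Import GRing.Theory.

Local Open Scope ring_scope.

Definition alg_dual (K : fieldType) (V : lmodType K) : Type := {scalar V}.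

Identity Coercion scalar_of_alg_dual : alg_dual >-> GRing.Linear.type.

Section AlgDual.
Variables (K : fieldType) (V : lmodType K).
Implicit Types S T U : alg_dual V.

HB.instance Definition _ := gen_eqMixin (alg_dual V).
HB.instance Definition _ := gen_choiceMixin (alg_dual V).

Lemma alg_dual_ext S T : S =1 T -> S = T.
Proof.
case: S T => [f cf] [g cg] /funext /= fg.
case: g / fg cg => cg; congr GRing.Linear.Pack.
case: cf cg => [[a] [b]] [[c] [d]].
by rewrite (Prop_irrelevance a c) (Prop_irrelevance b d).
Qed.

Definition alg_dual_zero : alg_dual V := (\0 : V -> K) : {scalar V}.
Definition alg_dual_opp T : alg_dual V := (\- T) : {scalar V}.
Definition alg_dual_add S T : alg_dual V := (S \+ T) : {scalar V}.

Fact alg_dual_addA : associative alg_dual_add.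
Proof. by move=> S T U; apply: alg_dual_ext => x; exact: addrA. Qed.

Fact alg_dual_addC : commutative alg_dual_add.
Proof. by move=> S T; apply: alg_dual_ext => x; exact: addrC. Qed.

Fact alg_dual_add0 : left_id alg_dual_zero alg_dual_add.
Proof. by move=> T; apply: alg_dual_ext => x; exact: add0r. Qed.

Fact alg_dual_addN : left_inverse alg_dual_zero alg_dual_opp alg_dual_add.
Proof. by move=> T; apply: alg_dual_ext => x; exact: addNr. Qed.

HB.instance Definition _ := GRing.isZmodule.Build (alg_dual V)
  alg_dual_addA alg_dual_addC alg_dual_add0 alg_dual_addN.

Definition scale_functional (a : K) T : V -> K := fun x => a * T x.

Fact scale_functional_is_scalar a T : scalar (scale_functional a T).
Proof.
by move=> b x y; rewrite /scale_functional scalarP mulrDr mulrCA.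
Qed.

HB.instance Definition _ (a : K) T := GRing.isLinear.Build K V K *%R
  (scale_functional a T) (scale_functional_is_scalar a T).

Definition alg_dual_scale (a : K) T : alg_dual V :=
  (scale_functional a T) : {scalar V}.

Fact alg_dual_scaleA a b T :
  alg_dual_scale a (alg_dual_scale b T) = alg_dual_scale (a * b) T.
Proof. by apply: alg_dual_ext => x; exact: mulrA. Qed.

Fact alg_dual_scale1 : left_id 1 alg_dual_scale.
Proof. by move=> T; apply: alg_dual_ext => x; exact: mul1r. Qed.

Fact alg_dual_scaleDr : right_distributive alg_dual_scale +%R.
Proof. by move=> a S T; apply: alg_dual_ext => x; exact: mulrDr. Qed.

Fact alg_dual_scaleDl T : {morph alg_dual_scale^~ T : a b / a + b}.
Proof. by move=> a b; apply: alg_dual_ext => x; exact: mulrDl. Qed.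

HB.instance Definition _ := GRing.Zmodule_isLmodule.Build K (alg_dual V)
  alg_dual_scaleA alg_dual_scale1 alg_dual_scaleDr alg_dual_scaleDl.

Definition dual_op (f : {linear V -> V}) T : alg_dual V :=
  (T \o f) : {scalar V}.

Fact dual_op_is_linear (f : {linear V -> V}) : linear (dual_op f).
Proof. by move=> a S T; apply: alg_dual_ext. Qed.

HB.instance Definition _ (f : {linear V -> V}) :=
  GRing.isLinear.Build K (alg_dual V) (alg_dual V) *:%R (dual_op f)
    (dual_op_is_linear f).

End AlgDual.

(* Main.v *)
(** If [f] is injective and [T] is a functional on its source, Zorn's lemma
    yields a maximal linear relation [M] between [V] and [K] whose only value
    at [f x] is [T x].  Being maximal, [M] contains the graph of [T] along [f],
    hence is total, hence is the graph of a functional [S] with [S \o f = T].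
    Conversely, if [f z = 0] then every [S \o f] kills [z], while, for [z != 0],
    extending the identity along [a |-> a *: z] gives a functional that does
    not. *)
Require Import Defs.
From HB Require Import structures.
From mathcomp Require Import all_boot all_algebra.
From mathcomp Require Import boolp classical_sets functions.

Import GRing.Theory.

Local Open Scope classical_set_scope.
Local Open Scope ring_scope.

Section ExtensionAlongInjection.
Variables (K : fieldType) (W V : lmodType K).
Variables (f : {linear W -> V}) (T : {scalar W}).
Hypothesis f_inj : injective f.

(* The empty relation is allowed, so that the union of an empty chain is
   admissible in Zorn's lemma. *)
Definition linear_relation_over (M : set (V * K^o)) : Prop :=
  (forall c p q, M p -> M q -> M (c *: p + q)) /\
  (forall x k, M (f x, k) -> k = T x).

Lemma linear_relation_over_bigcup (F : set (set (V * K^o))) :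
  F `<=` linear_relation_over -> total_on F subset ->
  linear_relation_over (\bigcup_(X in F) X).
Proof.
move=> FP Ftot; split=> [c p q [X FX Xp] [Y FY Yq]|x k [X FX Xxk]]; last first.
  exact: (FP _ FX).2 Xxk.
have [XY|YX] := Ftot _ _ FX FY.
  by exists Y => //; apply: (FP _ FY).1 => //; exact: XY.
by exists X => //; apply: (FP _ FX).1 => //; exact: YX.
Qed.

(** The shape in which [Zorn_bigcup] delivers a maximal element. *)
Definition maximal_over (M : set (V * K^o)) : Prop :=
  linear_relation_over M /\
  forall N, M `<` N -> ~ linear_relation_over N.

Lemma maximal_overE M N : maximal_over M -> M `<=` N ->
  linear_relation_over N -> N `<=` M.
Proof.
by move=> [_ Mmax] MN NP; apply: contrapT => NM; apply: (Mmax N).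
Qed.

(** This rules out the empty relation. Adjoining 0 is harmless because [f x = 0] forces [x = 0] by
    injectivity, hence [T x = 0]. *)
Lemma maximal_over0 M : maximal_over M -> M 0.
Proof.
move=> maxM; have [[Mlin Mf] _] := maxM.
apply: (maximal_overE _ (M `|` [set 0]) maxM) => [p Mp||]; [by left| |by right].
(* As soon as [M] has an element [p], it contains [- p + p = 0]. *)
have M0 c p : M p -> M (c *: p).
  move=> Mp; have := Mlin (-1) _ _ Mp Mp; rewrite scaleN1r addNr => M0.
  by rewrite -[c *: p]addr0; apply: Mlin.
split=> [c p q [Mp|->] [Mq|->]|x k [|[fx ->]]].
- by left; exact: Mlin.
- by left; rewrite addr0; exact: M0.
- by left; rewrite scaler0 add0r.
- by right; rewrite scaler0 add0r.
- exact: Mf.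
- by rewrite (f_inj x 0) ?linear0.
Qed.

(** The relation [N] spanned by [M] and [(u, c)] is again admissible: the second hypothesis is
    exactly its condition at the points [f x]. Maximality then puts [N] inside [M]. *)
Lemma maximal_over_adjoin M u c : maximal_over M ->
  (forall x k a, M (f x - a *: u, k - a * c) -> k = T x) -> M (u, c).
Proof.
move=> maxM uc; have [[Mlin Mf] _] := maxM.
have M0 := maximal_over0 M maxM.
pose N := [set p | exists a, M (p - a *: ((u, c) : V * K^o))].
apply: (maximal_overE M N maxM) => [p Mp||].
- by exists 0; rewrite scale0r subr0.
- split=> [d p q [a Mp] [b Mq]|x k [a]]; last exact: uc.
  exists (d * a + b).
  suff -> : d *: p + q - (d * a + b) *: ((u, c) : V * K^o) =
    d *: (p - a *: ((u, c) : V * K^o)) + (q - b *: ((u, c) : V * K^o)).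
    exact: Mlin.
  by rewrite scalerBr scalerA scalerDl opprD addrACA.
- by exists 1; rewrite scale1r subrr.
Qed.

Lemma maximal_over_graph M x : maximal_over M -> M (f x, T x).
Proof.
move=> maxM; apply: maximal_over_adjoin => // y k a.
rewrite -linearZ -linearB => /maxM.1.2 /eqP.
by rewrite linearB linearZ /= subr_eq subrK => /eqP.
Qed.

Lemma maximal_over_total M u : maximal_over M -> exists c, M (u, c).
Proof.
move=> maxM; have [[Mlin Mf] _] := maxM.
have M0 := maximal_over0 M maxM.
(* If [u] had no value, any value could be adjoined without conflict; 0 is the simplest. *)
apply: contrapT => Mu; apply: (Mu); exists 0.
apply: maximal_over_adjoin => // x k a; rewrite mulr0 subr0.
have [->|a0] := eqVneq a 0; first by rewrite scale0r subr0; exact: Mf.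
(* Subtracting [(f x - a *: u, k)] from [(f x, T x)] leaves [(a *: u, T x - k)]; dividing by [a]
   gives [u] a value after all. *)
move=> Mxk; exfalso; apply: Mu; exists (a^-1 * (T x - k)).
have := Mlin (-1) _ _ Mxk (maximal_over_graph M x maxM).
move=> /(Mlin a^-1)/(_ M0); rewrite addr0.
suff -> : a^-1 *: (-1 *: (f x - a *: u, k : K^o) + (f x, T x : K^o)) =
          (u, a^-1 * (T x - k)) by [].
congr pair => /=; last by rewrite scaleN1r addrC.
by rewrite scaleN1r opprB subrK scalerA mulVf // scale1r.
Qed.

Lemma scalar_extension : exists S : {scalar V}, S \o f =1 T.
Proof.
have [M maxM] := Zorn_bigcup linear_relation_over_bigcup.
have [[Mlin Mf] _] := maxM.
(* Two values at [u] differ by a value at [0 = f 0], which must be [T 0 = 0]. *)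
have Muniq u c d : M (u, c) -> M (u, d) -> c = d.
  move=> Mc Md; have := Mlin (-1) _ _ Mc Md.
  have -> : -1 *: (u, c : K^o) + (u, d : K^o) = (f 0, d - c).
    by congr pair => /=; rewrite scaleN1r ?linear0 ?addNr // addrC.
  by move=> /Mf/eqP; rewrite linear0 subr_eq0 => /eqP.
have /choice[S MS] u := maximal_over_total M u maxM.
have Slin : scalar S.
  move=> a u v; apply: (Muniq _ _ _ (MS _)).
  exact: (Mlin a _ _ (MS u) (MS v)).
pose SL : {scalar V} := HB.pack S (GRing.isLinear.Build K V K *%R S Slin).
by exists SL => x; exact/Mf/MS.
Qed.

End ExtensionAlongInjection.

Lemma scalar_separates (K : fieldType) (V : lmodType K) (z : V) :
  z != 0 -> exists S : {scalar V}, S z = 1.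
Proof.
move=> z0; pose g (a : K^o) : V := a *: z.
have glin : linear g by move=> a b c; rewrite /g scalerDl scalerA.
pose gL : {linear K^o -> V} :=
  HB.pack g (GRing.isLinear.Build K K^o V *:%R g glin).
have g_inj : injective gL.
  by move=> a b /eqP; rewrite -subr_eq0 -scalerBl scaler_eq0 (negPf z0) orbF
    subr_eq0 => /eqP.
pose idK (a : K^o) : K := a.
have idlin : scalar idK by [].
pose idL : {scalar K^o} :=
  HB.pack idK (GRing.isLinear.Build K K^o K *%R idK idlin).
have [S SE] := scalar_extension K K^o V gL idL g_inj.
(* [z] is the image of 1 under [g], so [S z] is the identity evaluated at 1. *)
by exists S; rewrite -[z]scale1r; exact: SE.
Qed.

Theorem theorem5p4 (K : fieldType) (V : lmodType K) (f : {linear V -> V}) :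
  injective f <->
  set_surj [set: alg_dual V] [set: alg_dual V]
    (dual_op f : {linear alg_dual V -> alg_dual V}).
Proof.
split=> [f_inj T _|f_surj x y fxy].
  have [S SE] := scalar_extension K V V f T f_inj.
  by exists S => //; apply: alg_dual_ext.
apply/eqP; rewrite -subr_eq0; apply: contrapT => /negP.
move=> /scalar_separates[T T1]; have [S _ ST] := f_surj T I.
(* [S] composed with [f] takes the value 1 at [x - y], yet [f] sends [x - y] to 0. *)
have : (dual_op f S : {scalar V}) (x - y) = 1 by rewrite -T1 -ST.
rewrite /= linearB fxy subrr linear0 => /eqP.
by rewrite eq_sym oner_eq0.
Qed.
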